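(* Let $E$ be an atomless order complete vector lattice, let $(V,E)$ be a Banach–Kantorovich space with $E$-valued vector norm $|\cdot|_V:V\to E$, and let $X$ be a Banach space. Then every $GAM$-compact, $(bo)$-norm continuous linear operator $T:V\to X$ is narrow.
   Context: Vector spaces are real and vector lattices are real and Archimedean. A lattice-normed space $(V,E)$ is a vector space $V$ with a vector lattice $E$ and a map $|\cdot|_V:V\to E$ (vector norm) such that $|v|_V\ge 0$, $|v|_V=0\iff v=0$, $|v_1+v_2|_V\le |v_1|_V+|v_2|_V$, $|\lambda v|_V=|\lambda||v|_V$ for $\lambda\in\mathbb R$. It is decomposable if whenever $x\in V$, $|x|_V=e_1+e_2$ with $e_1,e_2\in E_+$, there are $x_1,x_2\in V$ with $x=x_1+x_2$ and $|x_k|_V=e_k$ ($k=1,2$). A net $(v_\alpha)_{\alpha\in\Delta}$ in $V$ $(bo)$-converges to $v\in V$ if there is a decreasing net $(e_\gamma)_{\gamma\in\Gamma}$ in $E$ with $\inf_\gamma e_\gamma=0$ such that for every $\gamma$ there is $\alpha(\gamma)\in\Delta$ with $|v-v_\alpha|_V\le e_\gamma$ for all $\alpha\ge\alpha(\gamma)$. A net $(v_\alpha)$ is $(bo)$-fundamental if $(v_\alpha-v_\beta)_{(\alpha,\beta)\in\Delta\times\Delta}$ $(bo)$-converges to $0$; $V$ is $(bo)$-complete if every $(bo)$-fundamental net $(bo)$-converges in $V$. A Banach–Kantorovich space is a decomposable $(bo)$-complete lattice-normed space. An atom of $E$ is an element $e>0$ such that $0\le f_1\le e$, $0\le f_2\le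 e$, $f_1\wedge f_2=0$ imply $f_1=0$ or $f_2=0$; $E$ is atomless if it has no atoms. Elements $x,y\in V$ are disjoint ($x\perp y$) if $|x|_V\wedge|y|_V=0$. An element $z\in V$ is a fragment of $x\in V$ if $|z|_V\le |x|_V$ and $z\perp(x-z)$. Two fragments $x_1,x_2$ of $x$ are mutually complemented ($MC$) if $x=x_1+x_2$. A linear operator $T:V\to X$ is narrow if for every $u\in V$ and $\varepsilon>0$ there are $MC$ fragments $u_1,u_2$ of $u$ with $\|T(u_1-u_2)\|<\varepsilon$. A set $M\subset V$ is $(bo)$-bounded if there is $e\in E_+$ with $|v|_V\le e$ for all $v\in M$. A linear operator $T:V\to X$ is $GAM$-compact if $T(M)$ is relatively compact in $X$ for every $(bo)$-bounded $M\subset V$. It is $(bo)$-norm continuous if it sends every $(bo)$-convergent net in $V$ to a norm convergent net in $X$. *)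

(* Defs.v *)
From HB Require Import structures.
From mathcomp Require Import all_boot all_order all_algebra.
From mathcomp Require Import all_classical all_reals all_analysis.

Set Implicit Arguments.
Unset Strict Implicit.
Unset Printing Implicit Defensive.

Import Order.TTheory GRing.Theory Num.Theory.
Import numFieldNormedType.Exports.

Local Open Scope classical_set_scope.
Local Open Scope ring_scope.

(* Real Archimedean vector lattices. [Order.Lattice ring_display] cannot be
   combined with [GRing.Lmodule]: the join would have to be declared below
   [Num.RealDomain] in the hierarchy. Hence the lattice operations are fields. *)
HB.mixin Record POrderedLmodule_isVectorLattice (R : realType) E
    of GRing.Lmodule R E & Num.POrderedZmodule E := {
  vmeet : E -> E -> E ;
  vjoin : E -> E -> E ;
  le_vmeet : forall x y z : E, (z <= vmeet x y) = (z <= x) && (z <= y) ;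
  vjoin_le : forall x y z : E, (vjoin x y <= z) = (x <= z) && (y <= z) ;
  vl_lerD2r : forall z x y : E, x <= y -> x + z <= y + z ;
  vl_scaler_ge0 : forall (a : R) (x : E), 0 <= a -> 0 <= x -> 0 <= a *: x ;
  vl_archimedean : forall x y : E, (forall n : nat, x *+ n <= y) -> x <= 0
}.

#[short(type="vectorLatticeType")]
HB.structure Definition VectorLattice (R : realType) :=
  { E of GRing.Lmodule R E & Num.POrderedZmodule E
       & POrderedLmodule_isVectorLattice R E }.

Definition order_complete (R : realType) (E : vectorLatticeType R) : Prop :=
  forall A : set E, has_sup A -> supremums A !=set0.

Definition atom (R : realType) (E : vectorLatticeType R) (e : E) : Prop :=
  0 < e /\
  forall f1 f2 : E, 0 <= f1 <= e -> 0 <= f2 <= e -> vmeet f1 f2 = 0 ->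
    f1 = 0 \/ f2 = 0.

Definition atomless (R : realType) (E : vectorLatticeType R) : Prop :=
  forall e : E, ~ atom e.

(* The library's [Num.NormedZmodule E] (values in a porderZmodType) cannot be
   reused: its join with [GRing.Lmodule R], for R distinct from E, would have to
   be declared below [NormedModule]. *)
HB.mixin Record Lmodule_isLatticeNormed (R : realType)
    (E : vectorLatticeType R) V of GRing.Lmodule R V := {
  vnorm : V -> E ;
  vnorm_ge0 : forall v, 0 <= vnorm v ;
  vnorm_eq0 : forall v, vnorm v = 0 <-> v = 0 ;
  ler_vnormD : forall v1 v2, vnorm (v1 + v2) <= vnorm v1 + vnorm v2 ;
  vnormZ : forall (a : R) v, vnorm (a *: v) = `|a| *: vnorm v
}.

#[short(type="latticeNormedType")]
HB.structure Definition LatticeNormed (R : realType)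
    (E : vectorLatticeType R) :=
  { V of GRing.Lmodule R V & Lmodule_isLatticeNormed R E V }.

(* Index sets of nets are nonempty directed preorders. *)
Record directed (D : Type) (le : D -> D -> Prop) : Prop := Directed {
  directed_inhabited : inhabited D ;
  directed_refl : forall a, le a a ;
  directed_trans : forall a b c, le a b -> le b c -> le a c ;
  directed_ub : forall a b, exists c, le a c /\ le b c
}.

Definition prod_le (D : Type) (le : D -> D -> Prop) (p q : D * D) : Prop :=
  le p.1 q.1 /\ le p.2 q.2.

Definition tails (D : Type) (le : D -> D -> Prop) : set_system D :=
  filter_from [set: D] (fun a => [set b | le a b]).

Section LatticeNormedSpaces.
Context {R : realType} {E : vectorLatticeType R}.
Implicit Type V : latticeNormedType E.

Definition decomposable V : Prop :=
  forall (x : V) (e1 e2 : E), 0 <= e1 -> 0 <= e2 -> vnorm x = e1 + e2 ->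
    exists x1 x2 : V, [/\ x = x1 + x2, vnorm x1 = e1 & vnorm x2 = e2].

Definition bo_cvg_to V (D : Type) (le : D -> D -> Prop) (v : D -> V) (l : V)
    : Prop :=
  exists (G : Type) (leG : G -> G -> Prop) (e : G -> E),
    [/\ directed leG,
        forall g h, leG g h -> e h <= e g,
        infimums (range e) 0 &
        forall g, exists a, forall b, le a b -> vnorm (l - v b) <= e g].

Definition bo_fundamental V (D : Type) (le : D -> D -> Prop) (v : D -> V)
    : Prop :=
  bo_cvg_to (prod_le le) (fun p => v p.1 - v p.2) 0.

Definition bo_complete V : Prop :=
  forall (D : Type) (le : D -> D -> Prop) (v : D -> V),
    directed le -> bo_fundamental le v -> exists l, bo_cvg_to le v l.

Definition Banach_Kantorovich V : Prop := decomposable V /\ bo_complete V.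

Definition disjoint_elts V (x y : V) : Prop := vmeet (vnorm x) (vnorm y) = 0.

Definition fragment V (z x : V) : Prop :=
  vnorm z <= vnorm x /\ disjoint_elts z (x - z).

Definition MC_fragments V (x x1 x2 : V) : Prop :=
  [/\ fragment x1 x, fragment x2 x & x = x1 + x2].

Definition bo_bounded V (M : set V) : Prop :=
  exists2 e : E, 0 <= e & forall v, M v -> vnorm v <= e.

Section Operators.
Context {V : latticeNormedType E} {X : normedModType R}.
Implicit Type T : {linear V -> X}.

Definition narrow T : Prop :=
  forall (u : V) (eps : R), 0 < eps ->
    exists u1 u2 : V, MC_fragments u u1 u2 /\ `|T (u1 - u2)| < eps.

Definition GAM_compact T : Prop :=
  forall M : set V, bo_bounded M -> precompact (T @` M).

Definition bo_norm_continuous T : Prop :=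
  forall (D : Type) (le : D -> D -> Prop) (v : D -> V),
    directed le -> (exists l, bo_cvg_to le v l) ->
    exists x : X, T \o v @ tails le --> x.

End Operators.
End LatticeNormedSpaces.

(* Main.v *)
(* For a decomposition of [u] into pairwise disjoint [x_1, ..., x_N], signs
   [s_i] give MC fragments of [u] whose difference is [\sum s_i x_i]; so it is
   enough to make [T (\sum s_i x_i)] small.
   By compactness there are finitely many functionals [phi_1, ..., phi_m] on [X]
   such that [|v| <= |u|] and [phi_j (T v) = 0] for all [j] imply that [T v] is
   small. As [E] is atomless and [T] is continuous, [u] splits into disjoint
   pieces [x_i] with [T x_i] so small that [m] of them are negligible. Finally
   the polytope of the [a] in [[-1, 1]^N] with [\sum a_i phi_j (T x_i) = 0] for
   all [j] has a vertex, which has at most [m] coordinates different from 1 and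
   -1: rounding these off gives the signs. *)
Require Import Defs.
From mathcomp Require Import all_boot all_order all_algebra.
From mathcomp Require Import all_classical all_reals all_analysis.

Set Implicit Arguments.
Unset Strict Implicit.
Unset Printing Implicit Defensive.

Import Order.TTheory GRing.Theory Num.Theory.
Import numFieldNormedType.Exports.

Local Open Scope classical_set_scope.
Local Open Scope ring_scope.

(** * Disjointness and components in a vector lattice *)

Section VectorLattice.
Context {R : realType} {E : vectorLatticeType R}.
Implicit Types (x y z a b c e f g : E).

Lemma vl_lerD2 z x y : (x + z <= y + z) = (x <= y).
Proof.
apply/idP/idP => [h|]; last exact: vl_lerD2r.
by rewrite -(addrK z x) -(addrK z y); exact: vl_lerD2r.
Qed.

Lemma vl_lerD2l z x y : (z + x <= z + y) = (x <= y).
Proof. by rewrite ![z + _]addrC vl_lerD2. Qed.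

Lemma vl_lerD x y z t : x <= y -> z <= t -> x + z <= y + t.
Proof.
by move=> xy zt; apply: (@le_trans _ _ (y + z)); rewrite ?vl_lerD2 ?vl_lerD2l.
Qed.

Lemma vl_lerBlDr z x y : (x - z <= y) = (x <= y + z).
Proof. by rewrite -[LHS](vl_lerD2 z) subrK. Qed.

Lemma vl_lerBrDr z x y : (x <= y - z) = (x + z <= y).
Proof. by rewrite -[LHS](vl_lerD2 z) subrK. Qed.

Lemma vl_subr_ge0 x y : (0 <= y - x) = (x <= y).
Proof. by rewrite vl_lerBrDr add0r. Qed.

Lemma vl_lerN2 x y : (- x <= - y) = (y <= x).
Proof. by rewrite -[LHS](vl_lerD2 (x + y)) addKr [x + y]addrC addKr. Qed.

Lemma vl_addr_ge0 x y : 0 <= x -> 0 <= y -> 0 <= x + y.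
Proof. by move=> x0 y0; rewrite -[0]addr0 vl_lerD. Qed.

Lemma vl_lerDl x y : 0 <= y -> x <= x + y.
Proof. by move=> y0; rewrite -[leLHS]addr0 vl_lerD2l. Qed.

Lemma vl_lerBl x y : 0 <= y -> x - y <= x.
Proof. by move=> y0; rewrite vl_lerBlDr vl_lerDl. Qed.

Lemma vl_mulrn_ge0 x n : 0 <= x -> 0 <= x *+ n.
Proof.
by move=> x0; elim: n => [|n IHn]; rewrite ?mulr0n ?mulrS ?vl_addr_ge0.
Qed.

Lemma vl_addr_le_id x y : x <= x - y -> y <= 0.
Proof. by rewrite vl_lerBrDr -[leRHS]addr0 vl_lerD2l. Qed.

Lemma vmeetl x y : vmeet x y <= x.
Proof. by have := le_vmeet x y (vmeet x y); rewrite lexx => /esym/andP[]. Qed.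

Lemma vmeetr x y : vmeet x y <= y.
Proof. by have := le_vmeet x y (vmeet x y); rewrite lexx => /esym/andP[]. Qed.

Lemma vmeetC x y : vmeet x y = vmeet y x.
Proof. by apply/le_anti; rewrite !le_vmeet !vmeetl !vmeetr. Qed.

Lemma vmeet_eq0P x y : 0 <= x -> 0 <= y ->
  (forall z, 0 <= z -> z <= x -> z <= y -> z <= 0) -> vmeet x y = 0.
Proof.
move=> x0 y0 H; have m0 : 0 <= vmeet x y by rewrite le_vmeet x0.
by apply/le_anti; rewrite m0 H ?vmeetl ?vmeetr.
Qed.

Lemma vmeet_eq0_le x y z : vmeet x y = 0 -> z <= x -> z <= y -> z <= 0.
Proof. by move=> <- zx zy; rewrite le_vmeet zx. Qed.

Lemma vmeet_eq0S x y a b : vmeet x y = 0 -> 0 <= a <= x -> 0 <= b <= y ->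
  vmeet a b = 0.
Proof.
move=> xy /andP[a0 ax] /andP[b0 yb]; apply: vmeet_eq0P => // z _ za zb.
by apply: (vmeet_eq0_le xy); [exact: le_trans ax|exact: le_trans yb].
Qed.

(** If [t] is below [x] and [y + z], then [t - z] is below [x] and [y], hence nonpositive, so [t] is
    below both [x] and [z]. *)
Lemma vmeet_eq0D x y z : 0 <= x -> 0 <= y -> 0 <= z ->
  vmeet x y = 0 -> vmeet x z = 0 -> vmeet x (y + z) = 0.
Proof.
move=> x0 y0 z0 xy xz; apply: vmeet_eq0P; rewrite ?vl_addr_ge0// => t t0 tx tyz.
apply: (vmeet_eq0_le xz tx); rewrite -[z]add0r -vl_lerBlDr.
apply: (vmeet_eq0_le xy); last by rewrite vl_lerBlDr.
exact: le_trans (vl_lerBl _ _) tx.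
Qed.

Lemma vmeet_eq0Mn x y n : 0 <= x -> 0 <= y -> vmeet x y = 0 ->
  vmeet x (y *+ n) = 0.
Proof.
move=> x0 y0 xy; elim: n => [|n IHn]; last first.
  by rewrite mulrS vmeet_eq0D// vl_mulrn_ge0.
by apply: vmeet_eq0P.
Qed.

Lemma vmeet_eq0_leD x y z : vmeet x y = 0 -> x <= z -> y <= z -> x + y <= z.
Proof.
move=> xy xz yz; rewrite -[z]add0r -vl_lerBlDr; apply: (vmeet_eq0_le xy).
  by rewrite vl_lerBlDr vl_lerD2l.
by rewrite vl_lerBlDr addrC vl_lerD2l.
Qed.

Definition vfragment f e := [/\ 0 <= f, f <= e & vmeet f (e - f) = 0].

Lemma vfragment_refl e : 0 <= e -> vfragment e e.
Proof.
by move=> e0; split=> //; rewrite subrr; apply: vmeet_eq0P => // z _ _ ->.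
Qed.

Lemma vfragmentC f e : vfragment f e -> vfragment (e - f) e.
Proof.
move=> [f0 fe H]; split; rewrite ?vl_subr_ge0 ?vl_lerBl//.
by rewrite opprB addrCA subrr addr0 vmeetC.
Qed.

Lemma vfragment_trans g f e : vfragment g f -> vfragment f e -> vfragment g e.
Proof.
move=> [g0 gf Hg] [f0 fe Hf]; split=> //; first exact: le_trans fe.
rewrite -(subrKA f) vmeet_eq0D ?vl_subr_ge0//.
by apply: (vmeet_eq0S Hf); rewrite ?g0 ?gf// vl_subr_ge0 fe lexx.
Qed.

(** For [z] below [c] and [e - c], and [f] in [A], the element [c + z - f] is below both [f] and
    [e - f]. So [c + z] is a lower bound of [A], and [z <= 0]. *)
Lemma vfragment_inf (A : set E) e c : infimums A c ->
  A !=set0 -> (forall f, A f -> vfragment f e) -> vfragment c e.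
Proof.
move=> [lbc ubc] [f0 Af0] frA.
have c0 : 0 <= c by apply: ubc => f /frA[].
have ce : c <= e by have [_ fe _] := frA _ Af0; exact: le_trans (lbc _ Af0) fe.
split=> //; apply: vmeet_eq0P; rewrite ?vl_subr_ge0// => z z0 zc zec.
apply: (@vl_addr_le_id c); rewrite vl_lerBrDr; apply: ubc => f Af.
have [f_ge0 fe ff] := frA _ Af; have cf := lbc _ Af.
rewrite -[f]add0r -vl_lerBlDr; apply: (vmeet_eq0_le ff).
  by rewrite vl_lerBlDr vl_lerD// (le_trans zc).
by rewrite vl_lerD2 -vl_lerBrDr// -vl_lerBlDr opprK addrC -vl_lerBrDr.
Qed.

Hypothesis E_complete : order_complete E.

Lemma order_complete_inf (A : set E) e : A !=set0 ->
  (forall f, A f -> e <= f) -> infimums A !=set0.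
Proof.
move=> [f Af] lbA.
have [|s [ubs lbs]] := E_complete (A := -%R @` A).
  by split; [exists (- f), f|exists (- e) => _ [g /lbA ? <-]; rewrite vl_lerN2].
exists (- s); split=> [g Ag|g lbg].
  by rewrite -vl_lerN2 opprK; apply: ubs; exists g.
by rewrite -vl_lerN2 opprK; apply: lbs => _ [h Ah <-]; rewrite vl_lerN2 lbg.
Qed.

(* [g] is the component of [f] in the band generated by [f1]. *)
Lemma atomless_vfragment f : atomless E -> 0 < f ->
  exists g, [/\ vfragment g f, g != 0 & g != f].
Proof.
move=> atE f_gt0.
have [f1 [f2 [/andP[f10 f1f] /andP[f20 f2f] f12 [f1N0 f2N0]]]] : exists f1 f2,
    [/\ 0 <= f1 <= f, 0 <= f2 <= f, vmeet f1 f2 = 0 & f1 <> 0 /\ f2 <> 0].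
  apply: contrapT => H; apply: (atE f); split=> // f1 f2 h1 h2 h12.
  apply: contrapT => /not_orP Hn; apply: H; exists f1, f2; split=> //.
have f0 := ltW f_gt0.
pose w n := vmeet f (f1 *+ n).
have w0 n : 0 <= w n by rewrite le_vmeet f0 vl_mulrn_ge0.
have [|g [ubg lbg]] := E_complete (A := range w).
  by split; [exists (w 0), 0|exists f => _ [n _ <-]; exact: vmeetl].
have wg n : w n <= g by apply: ubg; exists n.
have gf : g <= f by apply: lbg => _ [n _ <-]; exact: vmeetl.
have f1g : f1 <= g by apply: le_trans (wg 1); rewrite le_vmeet f1f lexx.
(* Being disjoint from [f1], [z] is disjoint from each [w n], so [w n + z <= g]; the supremum over
   [n] gives [g + z <= g]. *)
have orth z : 0 <= z -> z <= g -> vmeet z f1 = 0 -> z <= 0.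
  move=> z0 zg zf1; apply: (@vl_addr_le_id g); apply: lbg => _ [n _ <-].
  rewrite vl_lerBrDr vmeet_eq0_leD// vmeetC.
  by apply: (vmeet_eq0S (vmeet_eq0Mn n z0 f10 zf1));
    rewrite ?z0 ?w0 ?lexx//= vmeetr.
exists g; split; last 2 first.
- apply/eqP => g0; apply: f1N0; apply/le_anti.
  by rewrite f10 -g0 f1g.
- apply/eqP => gE; apply: f2N0; apply/le_anti.
  by rewrite f20 orth// ?gE// vmeetC.
split=> //; first exact: le_trans (w0 0) (wg 0).
apply: vmeet_eq0P; rewrite ?vl_subr_ge0 ?(le_trans (w0 0) (wg 0))//.
move=> z z0 zg zfg; apply: orth => //; apply/le_anti.
rewrite le_vmeet z0 f10 !andbT.
(* Adding [vmeet z f1] to [w n] stays below [f], because [z <= f - g], and below [f1 *+ n.+1], hence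
   below [w n.+1]. *)
apply: (@vl_addr_le_id g); apply: lbg => _ [n _ <-].
rewrite vl_lerBrDr; apply: le_trans (wg n.+1); rewrite le_vmeet mulrSr.
rewrite (vl_lerD (vmeetr _ _) (vmeetr _ _)) andbT.
rewrite -[leRHS](subrK g) addrC vl_lerD//.
exact: le_trans (vmeetl _ _) zfg.
Qed.

End VectorLattice.

(** * Disjoint vectors and parts of a vector in a lattice-normed space *)

Section LatticeNormed.
Context {R : realType} {E : vectorLatticeType R} {V : latticeNormedType E}.
Implicit Types (u v w x y : V) (e f g : E).

Lemma vnormN v : vnorm (- v) = vnorm v.
Proof. by rewrite -scaleN1r vnormZ normrN1 scale1r. Qed.

Lemma vnorm0 : vnorm (0 : V) = 0.
Proof. exact/vnorm_eq0. Qed.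

Lemma vnorm_le0 v : vnorm v <= 0 -> v = 0.
Proof. by move=> v0; apply/vnorm_eq0/le_anti; rewrite v0 vnorm_ge0. Qed.

Lemma ler_vnormB v w : vnorm (v - w) <= vnorm v + vnorm w.
Proof. by rewrite -(vnormN w) ler_vnormD. Qed.

Lemma ler_vnorm_sum (I : Type) (s : seq I) (F : I -> V) :
  vnorm (\sum_(i <- s) F i) <= \sum_(i <- s) vnorm (F i).
Proof.
elim/big_rec2: _ => [|i e v _ ve]; first by rewrite vnorm0.
by rewrite (le_trans (ler_vnormD _ _))// vl_lerD2l.
Qed.

Lemma disjoint_eltsC v w : disjoint_elts v w -> disjoint_elts w v.
Proof. by rewrite /disjoint_elts vmeetC. Qed.

Lemma disjoint_elts0 v : disjoint_elts v 0.
Proof. by apply: vmeet_eq0P; rewrite ?vnorm_ge0 ?vnorm0. Qed.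

Lemma disjoint_elts_le v w x y : disjoint_elts v w ->
  vnorm x <= vnorm v -> vnorm y <= vnorm w -> disjoint_elts x y.
Proof. by move=> vw xv yw; apply: (vmeet_eq0S vw); rewrite vnorm_ge0. Qed.

Lemma disjoint_eltsD x v w :
  disjoint_elts x v -> disjoint_elts x w -> disjoint_elts x (v + w).
Proof.
move=> xv xw.
have H := vmeet_eq0D (vnorm_ge0 _) (vnorm_ge0 _) (vnorm_ge0 _) xv xw.
by apply: (vmeet_eq0S H); rewrite vnorm_ge0 ?ler_vnormD ?lexx.
Qed.

Lemma disjoint_elts_sum (I : Type) (s : seq I) (P : pred I) (F : I -> V) v :
  (forall i, P i -> disjoint_elts v (F i)) ->
  disjoint_elts v (\sum_(i <- s | P i) F i).
Proof.
move=> H; apply: big_rec => [|i w /H vi vw]; first exact: disjoint_elts0.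
exact: disjoint_eltsD.
Qed.

(** [vnorm v - vnorm (v + w)] is below [vnorm v] and [vnorm w], so disjointness gives
    [vnorm v <= vnorm (v + w)], and likewise for [w]. A sum of disjoint elements is below each of
    their common upper bounds. *)
Lemma disjoint_elts_vnormD v w :
  disjoint_elts v w -> vnorm (v + w) = vnorm v + vnorm w.
Proof.
have sub x y : vnorm x - vnorm (x + y) <= vnorm y.
  by rewrite vl_lerBlDr -{1}(addrK y x) [leRHS]addrC ler_vnormB.
have le x y : disjoint_elts x y -> vnorm x <= vnorm (x + y).
  move=> xy; rewrite -[leRHS]add0r -vl_lerBlDr.
  by apply: (vmeet_eq0_le xy (vl_lerBl _ (vnorm_ge0 _)) (sub _ _)).
move=> vw; apply/le_anti; rewrite ler_vnormD vmeet_eq0_leD ?le//.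
by rewrite addrC le//; exact: disjoint_eltsC.
Qed.

Lemma disjoint_elts_MC v w : disjoint_elts v w -> MC_fragments (v + w) v w.
Proof.
move=> vw; have le x y : disjoint_elts x y -> vnorm x <= vnorm (x + y).
  by move=> xy; rewrite disjoint_elts_vnormD// vl_lerDl ?vnorm_ge0.
have wv := disjoint_eltsC vw; split=> //; split; rewrite ?le//.
- by rewrite addrC addKr.
- by rewrite addrC le.
- by rewrite addrK.
Qed.

Definition pairwise_disjoint (s : seq V) : Prop :=
  pairwise (fun x y => vmeet (vnorm x) (vnorm y) == 0) s.

Lemma pairwise_disjoint_vnorm s : pairwise_disjoint s ->
  vnorm (\sum_(x <- s) x) = \sum_(x <- s) vnorm x.
Proof.
elim: s => [|x s IHs]; first by rewrite !big_nil vnorm0.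
move=> /= /andP[/allP xs ps]; rewrite !big_cons disjoint_elts_vnormD ?IHs//.
by rewrite big_seq; apply: disjoint_elts_sum => y /xs /eqP.
Qed.

Lemma pairwise_disjoint_le s x : pairwise_disjoint s -> x \in s ->
  vnorm x <= vnorm (\sum_(y <- s) y).
Proof.
move=> ds xs; rewrite pairwise_disjoint_vnorm// (big_rem x)//= vl_lerDl//.
by elim/big_ind: _ => [|y z|y _]; [|exact: vl_addr_ge0|exact: vnorm_ge0].
Qed.

Lemma pairwise_disjoint_cat s t :
  pairwise_disjoint s -> pairwise_disjoint t ->
  disjoint_elts (\sum_(x <- s) x) (\sum_(x <- t) x) ->
  pairwise_disjoint (s ++ t).
Proof.
move=> ds dt st; rewrite /pairwise_disjoint pairwise_cat.
apply/and3P; split=> //; apply/allrelP => x y xs yt; apply/eqP.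
by apply: (disjoint_elts_le st); exact: pairwise_disjoint_le.
Qed.

(** The norm of [v - w = (u - w) - (u - v)] is below twice [f] and below twice [vnorm u - f], which
    are disjoint. *)
Lemma vnorm_part_uniq u v w f : vfragment f (vnorm u) ->
  vnorm v = f -> vnorm (u - v) = vnorm u - f ->
  vnorm w = f -> vnorm (u - w) = vnorm u - f -> v = w.
Proof.
move=> [f0 fu ff] vf uvf wf uwf; apply/subr0_eq/vnorm_le0.
have uf0 : 0 <= vnorm u - f by rewrite vl_subr_ge0.
have ff2 : vmeet (f + f) ((vnorm u - f) + (vnorm u - f)) = 0.
  have H : vmeet (vnorm u - f) (f + f) = 0.
    by apply: vmeet_eq0D; rewrite // vmeetC.
  by apply: vmeet_eq0D => //; rewrite ?vl_addr_ge0// vmeetC.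
apply: (vmeet_eq0_le ff2); first by rewrite -{1}vf -wf ler_vnormB.
have -> : v - w = (u - w) - (u - v) by rewrite opprB [RHS]addrC subrKA.
by rewrite -{1}uwf -uvf ler_vnormB.
Qed.

Hypothesis V_decomposable : decomposable V.

(** [U f] is the part of [u] over the component [f]. Decomposability provides it, and uniqueness of
    parts makes the arbitrary choices additive. *)
Lemma vfragment_parts u : exists U : E -> V,
  (forall f, vfragment f (vnorm u) ->
     vnorm (U f) = f /\ vnorm (u - U f) = vnorm u - f) /\
  (forall f g, vfragment f (vnorm u) -> vfragment g f ->
     vnorm (U f - U g) = f - g /\ U (f - g) = U f - U g).
Proof.
have [U HU] : exists U : E -> V, forall f, vfragment f (vnorm u) ->
    vnorm (U f) = f /\ vnorm (u - U f) = vnorm u - f.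
  suff /choice[U HU] : forall f, exists x : V, vfragment f (vnorm u) ->
    vnorm x = f /\ vnorm (u - x) = vnorm u - f by exists U.
  move=> f.
  have [[f0 fu _]|] := pselect (vfragment f (vnorm u)); last by exists 0.
  have [|||x1 [x2 [uE x1f x2f]]] :=
    V_decomposable (x := u) (e1 := f) (e2 := vnorm u - f).
  - by [].
  - by rewrite vl_subr_ge0.
  - by rewrite addrC subrK.
  - by exists x1 => _; rewrite uE addrC addKr -uE.
exists U; split=> // f g ff gf; have gu := vfragment_trans gf ff.
have fgu : vfragment (f - g) (vnorm u).
  exact: vfragment_trans (vfragmentC gf) ff.
have [Uf uUf] := HU _ ff; have [Ug uUg] := HU _ gu; have [Ufg uUfg] := HU _ fgu.
have [g0 gf' _] := gf.
have [|||a [b [UfE ag bfg]]] :=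
    V_decomposable (x := U f) (e1 := g) (e2 := f - g).
- by [].
- by rewrite vl_subr_ge0.
- by rewrite addrC subrK.
(* By the triangle inequality both ways, [u - c] has norm exactly [vnorm u - e], so [c] is the part
   of [u] over [e]. *)
have part c d e : vfragment e (vnorm u) -> U f = c + d -> vnorm c = e ->
    vnorm d = f - e -> U e = c.
  move=> eu Ufcd ce dfe; have [Ue uUe] := HU _ eu.
  apply: (vnorm_part_uniq eu) => //; apply/le_anti/andP; split.
    have -> : u - c = (u - U f) + d by rewrite Ufcd opprD addrA subrK.
    by rewrite (le_trans (ler_vnormD _ _))// uUf dfe subrKA.
  by rewrite vl_lerBlDr -{1}(subrK c u) -ce ler_vnormD.
have Uga : U g = a by exact: part UfE _ _.
have Ufgb : U (f - g) = b.
  apply: (part _ a) => //; first by rewrite addrC.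
  by rewrite opprB addrC subrK.
by rewrite Ufgb Uga UfE addrC addKr.
Qed.

End LatticeNormed.

(** * Splitting a vector into disjoint pieces with small images *)

Section Partition.
Context {R : realType} {E : vectorLatticeType R} {V : latticeNormedType E}
        {X : completeNormedModType R} (T : {linear V -> X}).
Hypothesis T_continuous : bo_norm_continuous T.

(* Interlacing the net with the zero net identifies the limit of its image. *)
Lemma bo_norm_continuous_small (D : Type) (le : D -> D -> Prop) (w : D -> V)
    (eps : R) :
  directed le -> (forall c d, le c d -> vnorm (w d) <= vnorm (w c)) ->
  infimums (range (vnorm \o w)) 0 -> 0 < eps -> exists d, `|T (w d)| < eps.
Proof.
move=> [[d0] refl trans ub] anti inf0 eps0.
(* The order ignores the boolean, so every tail meets both nets. *)
pose leb (p q : D * bool) := le p.1 q.1.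
pose v (p : D * bool) := if p.2 then w p.1 else 0.
have dirb : directed leb.
  split; [by split; exact: (d0, true)|by move=> ?; exact: refl|
          by move=> ? ? ?; exact: trans|].
  by move=> p q; have [c [? ?]] := ub p.1 q.1; exists (c, true).
have [|x Tx] := T_continuous (v := v) dirb.
  exists 0, D, le, (vnorm \o w); split=> // d; exists (d, true) => -[c b].
  rewrite /leb /= => dc; rewrite sub0r vnormN /v; case: b => /=.
    exact: anti.
  by rewrite vnorm0 vnorm_ge0.
have /Tx [[d b] _ dP] : nbhs x (ball x (eps / 2)).
  by apply: nbhsx_ballx; rewrite divr_gt0.
have := dP (d, true) (refl d); have := dP (d, false) (refl d).
rewrite /= /v /= linear0 -!ball_normE /= subr0 => x_small Tw_small; exists d.
rewrite -(subrK x (T (w d))) (le_lt_trans (ler_normD _ _))// [eps]splitr.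
by rewrite ltrD// distrC.
Qed.

Definition finely_split (eta : R) (x : V) := exists s : seq V,
  [/\ pairwise_disjoint s, x = \sum_(y <- s) y &
      forall y, y \in s -> `|T y| < eta].

Lemma finely_split_small eta x : `|T x| < eta -> finely_split eta x.
Proof.
move=> Tx; exists [:: x].
by split=> [//||y /[!inE] /eqP ->//]; rewrite big_seq1.
Qed.

Lemma finely_splitD eta x y : disjoint_elts x y ->
  finely_split eta x -> finely_split eta y -> finely_split eta (x + y).
Proof.
move=> xy [s [ds xE sT]] [t [dt yE tT]]; exists (s ++ t); split.
- by apply: pairwise_disjoint_cat; rewrite // -xE -yE.
- by rewrite big_cat -xE -yE.
- by move=> z; rewrite mem_cat => /orP[/sT|/tT].
Qed.

(** Otherwise Zorn's lemma gives a minimal component [f] whose part [U f] cannot be finely split: by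
    continuity, the infimum of a chain of such components is again one. Atomlessness divides [f]
    into two smaller components; both can be finely split, and their splittings join. *)
Lemma atomless_finely_split (eta : R) (u : V) : atomless E ->
  order_complete E -> decomposable V -> 0 < eta -> finely_split eta u.
Proof.
move=> atE cE dV eta0; have [U [HU UB]] := vfragment_parts dV u.
have u_frag := vfragment_refl (vnorm_ge0 u).
have split_frag f g : vfragment f (vnorm u) -> vfragment g f ->
    finely_split eta (U g) -> finely_split eta (U (f - g)) ->
    finely_split eta (U f).
  move=> fu gf Ug Ufg; have [_ UfgE] := UB _ _ fu gf.
  have -> : U f = U g + U (f - g) by rewrite UfgE addrC subrK.
  apply: finely_splitD => //; rewrite /disjoint_elts.
  have gu := vfragment_trans gf fu.
  have fgu : vfragment (f - g) (vnorm u).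
    exact: vfragment_trans (vfragmentC gf) fu.
  by have [-> _] := HU _ gu; have [-> _] := HU _ fgu; case: gf.
have Uu : U (vnorm u) = u.
  apply/esym/subr0_eq/vnorm_le0; have [_ ->] := HU _ u_frag.
  by rewrite subrr.
apply: contrapT => u_bad.
pose bad f := vfragment f (vnorm u) /\ ~ finely_split eta (U f).
have bad_u : bad (vnorm u) by rewrite /bad Uu.
pose S := {f : E | bad f}.
(* [Zorn] yields maximal elements, so the order is reversed. *)
pose r (f g : S) := sval g <= sval f.
have [|f g h|[f ?] [g ?]|C totC|[f [fu f_bad]] f_min] := @Zorn S r.
- by move=> f; exact: lexx.
- by move=> fg gh; exact: le_trans gh fg.
- by rewrite /r /= => gf fg; apply: eq_exist; apply/le_anti/andP.
- have [->|/set0P[f0 Cf0]] := eqVneq C set0; first by exists (exist _ _ bad_u).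
  pose A := [set sval f | f in C].
  have frA f : A f -> vfragment f (vnorm u) by move=> [[g [? ?]] _ <-].
  have A0 : A !=set0 by exists (sval f0), f0.
  have [c infc] : infimums A !=set0.
    by apply: (order_complete_inf cE A0 (e := 0)) => f /frA[].
  have cu := vfragment_inf infc A0 frA.
  have [c0 _ c_orth] := cu.
  have cf f : A f -> vfragment c f.
    move=> Af; have [_ f_le _] := frA _ Af; have c_le := infc.1 _ Af.
    split=> //; apply: (vmeet_eq0S c_orth); rewrite ?c0 ?lexx//.
    by rewrite vl_subr_ge0 c_le vl_lerD2.
  suff c_bad : bad c.
    by exists (exist _ _ c_bad) => f Cf; apply: (infc.1); exists f.
  split=> // c_good.
  have w_norm f : A f -> vnorm (U f - U c) = f - c.
    by move=> Af; have [] := UB _ _ (frA _ Af) (cf _ Af).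
  (* The norms [f - c] decrease to 0 along the chain, so some [U f - U c] has image below [eta]. If
     [U c] could be finely split, adding this one piece would split [U f]. *)
  have [||||[f Af] /= Tf] := @bo_norm_continuous_small {f | A f}
      (fun f g => sval g <= sval f) (fun f => U (sval f) - U c) eta.
  - split; [by constructor; exists (sval f0), f0|by move=> ?; exact: lexx|
            by move=> ? ? ? fg gh; exact: le_trans gh fg|].
    move=> [f Af] [g Ag] /=; have [f' Cf' f'E] := Af; have [g' Cg' g'E] := Ag.
    have [fg|gf] := totC _ _ Cf' Cg'.
      by exists (exist _ _ Ag); rewrite /= lexx -f'E -g'E.
    by exists (exist _ _ Af); rewrite /= lexx -f'E -g'E.
  - by move=> [f Af] [g Ag] /=; rewrite !w_norm// vl_lerD2.
  - split=> [_ [[f Af] _ <-] /=|z lbz]; first exact: vnorm_ge0.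
    apply: (@vl_addr_le_id _ _ c); rewrite vl_lerBrDr addrC.
    apply: infc.2 => f Af; rewrite -vl_lerBrDr -w_norm//.
    by apply: lbz; exists (exist _ _ Af).
  - by [].
  have [f' _ f'E] := Af; have [_ f'_bad] := svalP f'; apply: f'_bad.
  have [_ UfcE] := UB _ _ (frA _ Af) (cf _ Af); rewrite f'E.
  apply: (split_frag _ _ (frA _ Af) (cf _ Af) c_good).
  by rewrite UfcE; exact: finely_split_small.
have [f0 _ _] := fu.
have f_gt0 : 0 < f.
  rewrite lt_neqAle f0 andbT; apply/eqP => f_eq0; apply: (f_bad).
  have [Uf _] := HU _ fu; apply: finely_split_small.
  by rewrite (_ : U f = 0) ?linear0 ?normr0//; apply/vnorm_eq0; rewrite Uf.
have [g [gf g0 gNf]] := atomless_vfragment cE atE f_gt0.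
have fine h : vfragment h f -> h != f -> finely_split eta (U h).
  move=> hf; apply: contra_neqP => h_bad.
  have bad_h : bad h by split=> //; exact: vfragment_trans hf fu.
  have := f_min (exist _ _ bad_h); rewrite /r /= => H.
  by have [_ /H/(congr1 sval)] := hf.
apply: (f_bad); apply: (split_frag _ _ fu gf); apply: fine => //.
  exact: vfragmentC.
by apply: contra_neq g0 => /eqP; rewrite subr_eq addrC -subr_eq subrr => /eqP.
Qed.
End Partition.

(** * The Hahn-Banach theorem for norming functionals *)

Section HahnBanach.
Context {R : realType} {X : normedModType R}.
Implicit Types (x y z : X) (G : set (X * R)).

(* Linear subspaces of [X * R] lying below the norm: by homogeneity these are
   the graphs of the partial functionals dominated by the norm. *)
Definition dominated_graph G :=
  (forall a x r y s, G (x, r) -> G (y, s) -> G (a *: x + y, a * r + s)) /\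
  (forall x r, G (x, r) -> r <= `|x|).

Lemma dominated_graph_uniq G x r s :
  dominated_graph G -> G (x, r) -> G (x, s) -> r = s.
Proof.
suff le r' s' : dominated_graph G -> G (x, r') -> G (x, s') -> r' <= s'.
  by move=> dG Gr Gs; apply/le_anti; rewrite !le.
move=> [linG leG] Gr Gs; have := leG _ _ (linG (-1) _ _ _ _ Gs Gr).
by rewrite scaleN1r addNr normr0 mulN1r addrC subr_le0.
Qed.

(** The value [c] at [z] has to lie above all [r - |x - z|] and below all [|y + z| - s], for
    [(x, r)] and [(y, s)] in [G]; the supremum of the former does. *)
Lemma dominated_graph_extend G z : dominated_graph G -> G (0, 0) ->
  exists2 G', dominated_graph G' & G `<=` G' /\ exists r, G' (z, r).
Proof.
move=> [linG leG] G0.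
have scaleG a x r : G (x, r) -> G (a *: x, a * r).
  by move=> Gx; have := linG a _ _ _ _ Gx G0; rewrite !addr0.
pose L := [set p.2 - `|p.1 - z| | p in G].
have L_le y s : G (y, s) -> ubound L (`|y + z| - s).
  move=> Gy _ [[x r] Gx <-] /=; rewrite lerBlDr addrAC lerBrDr.
  have := leG _ _ (linG 1 _ _ _ _ Gx Gy); rewrite scale1r mul1r.
  move=> /le_trans; apply.
  have -> : x + y = (y + z) + (x - z) by rewrite addrACA subrr addr0 addrC.
  exact: ler_normD.
have supL : has_sup L.
  by split; [exists (0 - `|0 - z|), (0, 0)|exists (`|0 + z| - 0); exact: L_le].
pose c := sup L.
have c_lb x r : G (x, r) -> r - `|x - z| <= c.
  by move=> Gx; apply: ub_le_sup; [exact: supL.2|exists (x, r)].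
have c_ub y s : G (y, s) -> c <= `|y + z| - s.
  by move=> Gy; apply: ge_sup; [exact: supL.1|exact: L_le].
exists [set p | exists x r t, G (x, r) /\ p = (x + t *: z, r + t * c)].
  split=> [a _ _ _ _ [x [r [t [Gx [-> ->]]]]] [y [s [t' [Gy [-> ->]]]]]|].
    exists (a *: x + y), (a * r + s), (a * t + t'); split; first exact: linG.
    by congr (_, _);
      rewrite ?mulrDr ?scalerDr ?scalerDl ?mulrDl ?scalerA ?mulrA addrACA.
  move=> _ _ [x [r [t [Gx [-> ->]]]]].
  (* Dividing by the absolute value of [t] reduces to the coefficients -1 and 1, which [c_lb] and
     [c_ub] settle. *)
  have [t0|t0|->] := ltgtP t 0; last by rewrite scale0r mul0r !addr0 leG.
    have nt0 : 0 < - t by rewrite oppr_gt0.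
    have := c_lb _ _ (scaleG (- t)^-1 _ _ Gx).
    have -> : (- t)^-1 *: x - z = (- t)^-1 *: (x + t *: z).
      by rewrite scalerDr scalerA invrN mulNr mulVf ?lt_eqF// scaleN1r.
    rewrite normrZ gtr0_norm ?invr_gt0// -mulrBr mulrC ler_pdivrMr//.
    by rewrite mulrN lerBlDr addrC lerBrDr [c * t]mulrC.
  have := c_ub _ _ (scaleG t^-1 _ _ Gx).
  have -> : t^-1 *: x + z = t^-1 *: (x + t *: z).
    by rewrite scalerDr scalerA mulVf ?gt_eqF// scale1r.
  rewrite normrZ gtr0_norm ?invr_gt0// -mulrBr mulrC ler_pdivlMr//.
  by rewrite lerBrDr addrC [c * t]mulrC.
split=> [[x r] Gx|]; first by exists x, r, 0; rewrite scale0r mul0r !addr0.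
by exists c, 0, 0, 1; rewrite scale1r mul1r !add0r.
Qed.

Theorem norming_functional x0 : exists phi : X -> R,
  [/\ forall a x y, phi (a *: x + y) = a * phi x + phi y,
      forall x, phi x <= `|x| & phi x0 = `|x0|].
Proof.
pose G0 : set (X * R) := [set (a *: x0, a * `|x0|) | a in setT].
have dG0 : dominated_graph G0.
  split=> [a _ _ _ _ [b _ [<- <-]] [c _ [<- <-]]|_ _ [a _ [<- <-]]].
    by exists (a * b + c) => //; rewrite scalerDl mulrDl scalerA mulrA.
  by rewrite normrZ ler_wpM2r ?normr_ge0 ?ler_norm.
(* Adjoining [G0] inside the predicate makes the empty chain harmless and forces the maximal graph
   to take the value [|x0|] at [x0]. *)
have [|A [dA A_max]] := @Zorn_bigcup _ (fun A => dominated_graph (A `|` G0)).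
  move=> F domF totF.
  have pick p q :
      (\bigcup_(A in F) A `|` G0) p -> (\bigcup_(A in F) A `|` G0) q ->
      exists G, [/\ dominated_graph G,
        G `<=` \bigcup_(A in F) A `|` G0, G p & G q].
    move=> [[A FA Ap]|G0p] [[B FB Bq]|G0q].
    - have sub C : F C -> C `|` G0 `<=` \bigcup_(A in F) A `|` G0.
        by move=> FC; apply: setSU => r Cr; exists C.
      have [AB|BA] := totF _ _ FA FB.
        exists (B `|` G0).
        by split; [exact: domF|exact: sub|left; exact: AB|left].
      exists (A `|` G0).
      by split; [exact: domF|exact: sub|left|left; exact: BA].
    - exists (A `|` G0); split; [exact: domF| |by left|by right].
      by apply: setSU => r Ar; exists A.
    - exists (B `|` G0); split; [exact: domF| |by right|by left].
      by apply: setSU => r Br; exists B.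
    - by exists G0; split => // r; right.
  split=> [a x r y s Gx Gy|x r Gx].
    by have [G [[linG _] subG Gx' Gy']] := pick _ _ Gx Gy; apply/subG/linG.
  by have [G [[_ leG] _ Gx' _]] := pick _ _ Gx Gx; exact: leG.
set G := A `|` G0 in dA.
have G00 : G (0, 0) by right; exists 0; rewrite ?scale0r ?mul0r.
have total z : exists r, G (z, r).
  have [G' dG' [GG' [r G'z]]] := dominated_graph_extend z dA G00.
  exists r; apply: contrapT => NGz; apply: (A_max G').
    split=> [p Ap|/(_ _ G'z) Az]; first by apply: GG'; left.
    by apply: NGz; left.
  by rewrite setUidl// => p G0p; apply: GG'; right.
have [phi phiG] := choice total; exists phi; split=> [a x y|x|].
- by apply: (dominated_graph_uniq dA (phiG _)); exact: dA.1.
- exact: dA.2.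
- apply: (dominated_graph_uniq dA (phiG _)); right.
  by exists 1; rewrite ?scale1r ?mul1r.
Qed.

End HahnBanach.

(** * Finitely many functionals controlling the norm on a precompact image *)

Lemma precompact_not_separated {R : realType} {X : normedModType R} (K : set X)
    (y : nat -> X) (eps : R) : precompact K -> 0 < eps ->
  (forall n, K (y n)) -> ~ (forall i j, (i < j)%N -> eps <= `|y i - y j|).
Proof.
rewrite precompactE => cK eps0 Ky sep.
(* The sequence clusters at some [p]; two of its terms within [eps / 2] of [p] contradict
   separation. *)
have [|p [_ yp]] := cK (y @ \oo) _.
  by exists 0 => // n _; apply: subset_closure; exact: Ky.
have near_p N : exists2 n, (N <= n)%N & `|p - y n| < eps / 2.
  have [||z [[n Nn <-] pz]] :=
    yp [set y n | n in [set n | (N <= n)%N]] (ball p (eps / 2)).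
  - by exists N => // n /= Nn; exists n.
  - by apply: nbhsx_ballx; rewrite divr_gt0.
  - by exists n => //; move: pz; rewrite -ball_normE.
have [i _ ip] := near_p 0; have [j ij jp] := near_p i.+1.
have := sep _ _ ij; rewrite leNgt => /negP; apply.
rewrite -(subrKA p) (le_lt_trans (ler_normD _ _))// [eps]splitr ltrD//.
by rewrite distrC.
Qed.

(* Otherwise, choosing repeatedly a point of [K] on which the image is large but
   annihilated by norming functionals of the previous images would give a
   separated sequence in the image. *)
Lemma precompact_Gelfand {R : realType} {V : lmodType R} {X : normedModType R}
    (T : {linear V -> X}) (K : set V) (eps : R) :
  precompact (T @` K) -> 0 < eps ->
  exists s : seq (X -> R),
    (forall phi : X -> R, phi \in s ->
       forall a x y, phi (a *: x + y) = a * phi x + phi y) /\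
    (forall v, K v -> (forall phi : X -> R, phi \in s -> phi (T v) = 0) ->
       `|T v| < eps).
Proof.
move=> cK eps0; apply: contrapT => no_s.
pose lin (phi : X -> R) := forall a x y, phi (a *: x + y) = a * phi x + phi y.
(* The linearity premise lets the choice be made for every list; [linS] discharges it for the lists
   actually built. *)
pose next (s : seq (X -> R)) (p : V * (X -> R)) :=
  (forall phi : X -> R, phi \in s -> lin phi) ->
  [/\ K p.1, forall phi, phi \in s -> phi (T p.1) = 0, eps <= `|T p.1|,
      lin p.2 & (forall x, p.2 x <= `|x|) /\ p.2 (T p.1) = `|T p.1|].
have /choice[F HF] : forall s, exists p, next s p.
  move=> s.
  have [lin_s|] := pselect (forall phi : X -> R, phi \in s -> lin phi);
    last by exists (0, fun=> 0).
  have [v [Kv v0 veps]] : exists v,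
      [/\ K v, forall phi, phi \in s -> phi (T v) = 0 & eps <= `|T v|].
    apply: contrapT => no_v; apply: no_s; exists s; split=> // v Kv v0.
    by rewrite ltNge; apply/negP => veps; apply: no_v; exists v.
  by have [phi [? ? ?]] := norming_functional (T v); exists (v, phi).
pose S := fix S n := if n is n'.+1 then (F (S n')).2 :: S n' else [::].
have linS n phi : phi \in S n -> lin phi.
  elim: n phi => [//|n IHn] phi /= /[!inE] /orP[/eqP->|/IHn//].
  by have [] := HF _ IHn.
have inS i j : (i < j)%N -> (F (S i)).2 \in S j.
  elim: j => [//|j IHj]; rewrite ltnS leq_eqVlt inE => /orP[/eqP->|/IHj->].
    by rewrite eqxx.
  by rewrite orbT.
apply: (@precompact_not_separated _ _ _ (fun n => T (F (S n)).1) _ cK eps0).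
  by move=> n; have [Kn _ _ _ _] := HF _ (linS n); exists (F (S n)).1.
move=> i j ij.
have [_ _ i_eps i_lin [i_le i_norm]] := HF _ (linS i).
have [_ /(_ _ (inS _ _ ij)) j0 _ _ _] := HF _ (linS j).
(* The [i]-th functional norms the [i]-th image and kills the [j]-th, so on their difference it
   still takes a value at least [eps]. *)
rewrite (le_trans i_eps)// -i_norm; apply: le_trans (i_le _).
by rewrite addrC -scaleN1r i_lin j0 mulr0 add0r.
Qed.

(** * Vertices of a linear section of the cube *)

Section Vertex.
Context {R : realFieldType}.

(** The rows of [A] indexed by [S] outnumber its columns, so they are linearly dependent; [P]
    extends the coefficients by zero outside [S]. *)
Lemma left_kernel_supported {N m : nat} (A : 'M[R]_(N, m)) (S : {set 'I_N}) :
  (m < #|S|)%N -> exists d : 'rV[R]_N,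
    [/\ d != 0, d *m A = 0 & forall i, i \notin S -> d 0 i = 0].
Proof.
move=> mS; pose P : 'M[R]_(#|S|, N) := \matrix_(k, i) (enum_val k == i)%:R.
have [v vP v0] : exists2 v : 'rV_#|S|, v *m (P *m A) = 0 & v != 0.
  have : kermx (P *m A) != 0.
    rewrite kermx_eq0 /row_free eqn_leq negb_and -!ltnNge orbC.
    by rewrite (leq_ltn_trans (rank_leq_col _) mS).
  move=> /rowV0Pn[v /sub_kermxP vK v0]; by exists v.
have dE i : (v *m P) 0 i = \sum_(k < #|S|) v 0 k * (enum_val k == i)%:R.
  by rewrite mxE; apply: eq_bigr => k _; rewrite mxE.
exists (v *m P); split; last 2 first.
- by rewrite -mulmxA.
- move=> i iS; rewrite dE big1// => k _.
  have [kE|_] := eqVneq (enum_val k) i; last by rewrite mulr0.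
  by move: iS; rewrite -kE enum_valP.
apply: contra_neq v0 => d0; apply/rowP => k; rewrite [RHS]mxE.
have := dE (enum_val k); rewrite d0 mxE (bigD1 k)//= eqxx mulr1 big1 ?addr0//.
by move=> j jk; rewrite (inj_eq enum_val_inj) (negbTE jk) mulr0.
Qed.

Definition inner_coords {N : nat} (a : 'rV[R]_N) : {set 'I_N} :=
  [set i | (`|a 0 i| < 1)%R]%SET.

(* As long as more than [m] coordinates lie strictly inside the interval, some
   line of the kernel moves only these; following it until one of them reaches 1
   or -1 decreases their number. *)
Lemma cube_vertex {N m : nat} (A : 'M[R]_(N, m)) : exists a : 'rV[R]_N,
  [/\ a *m A = 0, forall i, `|a 0 i| <= 1 &
      (#|inner_coords a| <= m)%N].
Proof.
suff descent k : forall a : 'rV[R]_N, a *m A = 0 -> (forall i, `|a 0 i| <= 1) ->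
    (#|inner_coords a| <= k)%N -> exists a : 'rV[R]_N,
    [/\ a *m A = 0, forall i, `|a 0 i| <= 1 & (#|inner_coords a| <= m)%N].
  by apply: (descent N 0);
    [rewrite mul0mx|move=> i; rewrite mxE normr0|
     rewrite -[leqRHS]card_ord max_card].
elim: k => [|k IHk] a aA a1 ak.
  by exists a; split=> //; exact: leq_trans ak _.
have [am|ma] := leqP #|inner_coords a| m; first by exists a.
have [d [d0 dA d_supp]] := left_kernel_supported A ma.
have /rV0Pn[j dj] := d0.
(* Moving from [a] along [d], coordinate [i] reaches the sign of [d 0 i] at time [t i]; [i0] is a
   first one to do so. *)
pose t i := (1 - Num.sg (d 0 i) * a 0 i) / `|d 0 i|.
pose i0 := [arg min_(i < j | d 0 i != 0) t i]%O.
have [di0 t_min] : d 0 i0 != 0 /\ forall i, d 0 i != 0 -> t i0 <= t i.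
  by rewrite /i0; case: arg_minP => // i di H.
have a_open i : d 0 i != 0 -> `|a 0 i| < 1.
  by move=> di; have := contra_neqN (d_supp i) di; rewrite negbK inE.
have sga i : Num.sg (d 0 i) * a 0 i <= 1.
  rewrite (le_trans (ler_norm _))// normrM normr_sg.
  by case: eqP => _; rewrite ?mul0r ?ler01 ?mul1r.
have t0 : 0 <= t i0 by rewrite divr_ge0// subr_ge0.
have move_sg i : d 0 i != 0 ->
    Num.sg (d 0 i) * (a + t i0 *: d) 0 i =
    Num.sg (d 0 i) * a 0 i + t i0 * `|d 0 i|.
  by move=> di; rewrite !mxE mulrDr mulrCA -normrEsg.
have norm_sg i (x : R) : d 0 i != 0 -> `|x| = `|Num.sg (d 0 i) * x|.
  by move=> di; rewrite normrM normr_sg di mul1r.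
apply: (IHk (a + t i0 *: d)).
- by rewrite mulmxDl aA -scalemxAl dA scaler0 addr0.
- move=> i; have [di|di] := eqVneq (d 0 i) 0.
    by rewrite !mxE di mulr0 addr0.
  (* After multiplication by the sign of [d 0 i], the lower bound holds since the coordinate grows,
     the upper one by minimality of [t i0]. *)
  rewrite (norm_sg i)// move_sg// ler_norml; apply/andP; split.
    rewrite -[leLHS]addr0 lerD// ?(mulr_ge0 t0 (normr_ge0 _))//.
    by have := a1 i; rewrite (norm_sg i)// ler_norml => /andP[].
  by have := t_min _ di; rewrite {2}/t ler_pdivlMr ?normr_gt0// lerBrDl.
(* Only inner coordinates move, so no new one appears, while [i0] reaches the boundary. *)
rewrite -ltnS; apply: leq_trans ak; apply: proper_card; apply/properP; split.
  apply/fintype.subsetP => i; rewrite !inE; have [di|di _] := eqVneq (d 0 i) 0.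
    by rewrite !mxE di mulr0 addr0.
  exact: a_open.
exists i0; rewrite inE ?a_open// -leNgt (norm_sg i0)// move_sg//.
by rewrite {1}/t divfK ?normr_eq0// addrC subrK normr1.
Qed.

End Vertex.

(** * Signed and bounded combinations of disjoint vectors *)

Section Rounding.
Context {R : realType} {E : vectorLatticeType R} {V : latticeNormedType E}.

Lemma pairwise_disjoint_MC (s : seq V) (P : pred 'I_(size s)) :
  pairwise_disjoint s ->
  MC_fragments (\sum_(x <- s) x)
    (\sum_(i < size s | P i) s`_i) (\sum_(i < size s | ~~ P i) s`_i).
Proof.
move=> ds; rewrite (big_nth 0) big_mkord (bigID P)/=; apply: disjoint_elts_MC.
have disj (i j : 'I_(size s)) : i != j -> disjoint_elts s`_i s`_j.
  move=> ij; have /pairwiseP := ds => /(_ 0) H.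
  move: ij; rewrite neq_ltn => /orP[ij|ji]; last apply: disjoint_eltsC.
    by apply/eqP/H; rewrite ?inE.
  by apply/eqP/H; rewrite ?inE.
apply: disjoint_elts_sum => j Pj.
apply/disjoint_eltsC/disjoint_elts_sum => i Pi.
by apply: disj; apply: contraNneq Pj => ->.
Qed.

Lemma pairwise_disjoint_combination (s : seq V) (a : 'I_(size s) -> R) :
  pairwise_disjoint s -> (forall i, `|a i| <= 1) ->
  vnorm (\sum_i a i *: s`_i) <= vnorm (\sum_(x <- s) x).
Proof.
move=> ds a1; rewrite pairwise_disjoint_vnorm// (big_nth 0) big_mkord.
apply: le_trans (ler_vnorm_sum _ _) _; elim/big_rec2: _ => // i x y _ yx.
rewrite vl_lerD// vnormZ -vl_subr_ge0 -[X in X - _]scale1r -scalerBl.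
by rewrite vl_scaler_ge0 ?vnorm_ge0// subr_ge0.
Qed.

End Rounding.

(** * Narrowness of the operator *)

Theorem theorem4p9 (R : realType) (E : vectorLatticeType R)
    (V : latticeNormedType E) (X : completeNormedModType R)
    (T : {linear V -> X}) :
  atomless E -> order_complete E -> Banach_Kantorovich V ->
  GAM_compact T -> bo_norm_continuous T -> narrow T.
Proof.
move=> atE cE [dV _] T_compact T_cont u eps eps0.
have [|Phi [Phi_lin Phi_small]] := precompact_Gelfand (T := T)
  (K := [set v | vnorm v <= vnorm u]) (eps := eps / 2) _
  (divr_gt0 eps0 (ltr0n _ 2)).
  by apply: T_compact; exists (vnorm u) => //; exact: vnorm_ge0.
(* Rounding costs at most [2 * eta] at each of at most [m] coordinates, in total at most [eps / 2];
   the successor keeps the divisor nonzero when [Phi] is empty. *)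
pose m := size Phi; pose eta := eps / 2 / (2 * m.+1%:R).
have eta0 : 0 < eta by rewrite !divr_gt0// mulr_gt0.
have [s [ds uE s_small]] := atomless_finely_split T_cont u atE cE dV eta0.
pose phi (j : 'I_m) := tnth (in_tuple Phi) j.
have [a [aA a1 am]] :=
  cube_vertex (\matrix_(i < size s, j < m) phi j (T s`_i)).
(* Coordinates equal to 1 or -1 keep their sign, and inner ones are rounded to 1. *)
pose P i := a 0 i != -1.
exists (\sum_(i < size s | P i) s`_i), (\sum_(i < size s | ~~ P i) s`_i).
split; first by rewrite uE; exact: pairwise_disjoint_MC.
pose sg i : R := if P i then 1 else -1.
(* The first sum is the vertex combination, whose image all functionals of [Phi] annihilate; the
   second is the rounding error. *)
have -> : \sum_(i < size s | P i) s`_i - \sum_(i < size s | ~~ P i) s`_i =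
    \sum_i a 0 i *: s`_i + \sum_i (sg i - a 0 i) *: s`_i.
  rewrite -big_split/= [RHS](bigID P)/= -sumrN; congr (_ + _);
    apply: eq_bigr => i iP; rewrite -scalerDl [X in X *: _]addrC subrK /sg.
    by rewrite iP scale1r.
  by rewrite (negbTE iP) scaleN1r.
rewrite linearD (le_lt_trans (ler_normD _ _))// [eps]splitr ltr_leD//.
  apply: Phi_small => [|f f_in].
    by rewrite /= uE pairwise_disjoint_combination.
  have f_lin := Phi_lin _ f_in.
  have f0 : f 0 = 0.
    have := f_lin 1 0 0; rewrite scaler0 addr0 mul1r => /eqP.
    by rewrite -subr_eq subrr => /eqP.
  have [k km fE] : exists2 k, (k < m)%N & f = nth f Phi k.
    by exists (index f Phi); rewrite ?index_mem ?nth_index.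
  have -> : f (T (\sum_i a 0 i *: s`_i)) = \sum_i a 0 i * f (T s`_i).
    rewrite linear_sum; elim/big_rec2: _ => [//|i x y _ <-].
    by rewrite linearZ f_lin.
  have /(congr1 (fun M : 'rV_m => M 0 (Ordinal km))) := aA; rewrite !mxE => aA0.
  rewrite -[RHS]aA0; apply: eq_bigr => i _; rewrite mxE /phi.
  by rewrite (tnth_nth f) /= -fE.
rewrite linear_sum (le_trans (ler_norm_sum _ _ _))//.
(* At an inner coordinate the coefficient is at most 2 in absolute value; at the others rounding
   changes nothing. *)
have term i : `|T ((sg i - a 0 i) *: s`_i)| <=
    if i \in inner_coords a then 2 * eta else 0.
  rewrite inE linearZ normrZ; case: ifPn => [ai|].
    rewrite ler_pM//; last by rewrite ltW// s_small// mem_nth.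
    rewrite (le_trans (ler_normB _ _))// -[2]/(1 + 1) lerD//.
    by rewrite /sg; case: ifP; rewrite ?normrN normr1.
  rewrite -leNgt => ai; have : `|a 0 i| == 1 by rewrite eq_le a1.
  rewrite eqr_norml ler01 andbT /sg /P => /orP[/eqP->|/eqP->].
    by rewrite -subr_eq0 opprK paddr_eq0// oner_eq0/= subrr normr0 mul0r.
  by rewrite eqxx/= subrr normr0 mul0r.
apply: le_trans (ler_sum _ (fun i _ => term i)) _.
rewrite -big_mkcond/= sumr_const -[leLHS]mulr_natl.
have mE : m.+1%:R * (2 * eta) = eps / 2.
  by rewrite mulrA mulrC [_ * 2]mulrC /eta divfK// mulf_neq0// pnatr_eq0.
rewrite -mE ler_wpM2r ?ler_nat ?leqW//.
by rewrite mulr_ge0// ltW.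
Qed.
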